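(* Let $T=\{s\in 2^{<\mathfrak p}: l(s)\text{ is a successor ordinal}\}\cup\{\emptyset\}$ and let $\{a_t:t\in 2^{<\mathfrak p}\}\subseteq[\omega]^\omega$ be any pseudointersection labeling of $2^{<\mathfrak p}$. Then the Stone space of the $T$-algebra generated by $\{a_t:t\in T\}$ is sequentially compact.
   Context: $[\omega]^\omega$ is the set of infinite subsets of $\omega$. A family $\mathcal F\subseteq[\omega]^\omega$ is centered if every finite subfamily has infinite intersection; a pseudointersection of $\mathcal F$ is a set $P$ with $P\setminus F$ finite for all $F\in\mathcal F$. The pseudointersection number $\mathfrak p$ is the least cardinality of a centered family with no infinite pseudointersection. $2^{<\mathfrak p}$ is the set of functions $s:\alpha\to 2$ with $\alpha<\mathfrak p$, ordered by inclusion ($t<s$ means $t\subsetneq s$); $l(s)=\mathrm{dom}(s)$ is the length of $s$; $t^\frown i$ is the extension of $t$ by the value $i$. Pseudointersection labeling: a family $\{a_t:t\in2^{<\mathfrak p}\}\subseteq[\omega]^\omega$ obtained by the following recursion on length (at every step the family of previously defined $a_t$ with $t<s$ is centered, so the choices are possible). Put $a_\emptyset=\omega$. If $l(s)$ is a limit ordinal, choose an infinite pseudointersection $P_s$ of $\{a_t:t<s\}$ and put $a_s=P_s$. For each $t\in2^{<\mathfrak p}$, choose an infinite pseudointersection $P$ of $\{a_r:r\le t\}$ and an infinite $P'\subseteq P$ with $P\setminus P'$ infinite, and put $a_{t^\frown0}=P'$, $a_{t^\frown1}=\omega\setminus P'$. All choices are arbitrary. The $T$-algebra generated by $\{a_t:t\in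 T\}$ is the Boolean subalgebra of $\mathcal P(\omega)$ generated by $\{a_t:t\in T\}$ together with all finite subsets of $\omega$ (all Boolean algebras considered contain all finite subsets of $\omega$). Note that only the labels of nodes in $T$ are used as generators, although the labels at limit levels enter the recursion. The Stone space of a Boolean algebra $\mathcal B$ is the space of all ultrafilters on $\mathcal B$ with base $\{b^*:b\in\mathcal B\}$, $b^*=\{u: b\in u\}$. A space is sequentially compact if every sequence has a convergent subsequence. *)

(* Defs.v *)
From HB Require Import structures.
From mathcomp Require Import all_boot all_order.
From mathcomp Require Import boolp classical_sets functions cardinality wochoice.
From mathcomp Require Import topology sequences.

Set Implicit Arguments.
Unset Strict Implicit.
Unset Printing Implicit Defensive.

Import Order.TTheory.
Local Open Scope order_scope.
Local Open Scope card_scope.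
Local Open Scope classical_set_scope.

Definition centered (F : set (set nat)) :=
  (forall A, F A -> infinite_set A) /\
  forall G, finite_set G -> G `<=` F -> infinite_set (\bigcap_(A in G) A).

Definition pseudointersection (F : set (set nat)) (P : set nat) :=
  forall A, F A -> finite_set (P `\` A).

Definition centered_without_pseudointersection (F : set (set nat)) :=
  centered F /\ ~ exists P, infinite_set P /\ pseudointersection F P.

(* Ordinals are not available as objects, so the cardinal p is given by any
   well-ordered type K of that order type; the ordinals below p are then the
   elements of K, and an ordinal a is identified with the initial segment
   [set b | b < a].  Such a K is unique up to isomorphism. *)

Definition initial_ordinal d (K : orderType d) :=
  well_order (<=%O : rel K) /\
  forall a : K, ~~ ([set: K] #<= [set b : K | b < a]).

Definition is_pseudointersection_number d (K : orderType d) :=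
  [/\ initial_ordinal K,
      exists F, centered_without_pseudointersection F /\ [set: K] #= F
    & forall F, centered_without_pseudointersection F -> [set: K] #<= F].

Section Nodes.
Context {d : Order.disp_t} {K : orderType d}.

Definition is_successor (a : K) := exists2 b, b < a & forall c, c < a -> c <= b.

Definition is_limit (a : K) := (exists b, b < a) /\ ~ is_successor a.

End Nodes.

Record node d (K : orderType d) := Node {
  len : K;
  val_at : {b : K | b < len} -> bool
}.

Section Tree.
Context {d : Order.disp_t} {K : orderType d}.
Implicit Types r s t : node K.

Definition graph s : set (K * bool) :=
  [set p | exists h : p.1 < len s, val_at (exist _ p.1 h) = p.2].

Definition node_le t s := graph t `<=` graph s.

Definition node_lt t s := graph t `<` graph s.

Definition is_empty s := graph s = set0.

(* s is the node t^i, that is, t extended by the pair (l(t), i). *)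
Definition is_extension t (i : bool) s := graph s = graph t `|` [set (len t, i)].

(* A labeling produced by the recursion is a family satisfying the constraint
   imposed at each step of it.  The bits 0 and 1 are false and true. *)
Definition pseudointersection_labeling (a : node K -> set nat) :=
  [/\ forall s, infinite_set (a s),
      forall s, is_empty s -> a s = setT,
      forall s, is_limit (len s) ->
        pseudointersection (a @` [set t | node_lt t s]) (a s)
    & forall t, exists P P',
        [/\ infinite_set P,
            pseudointersection (a @` [set r | node_le r t]) P,
            P' `<=` P, infinite_set P' & infinite_set (P `\` P')] /\
        (forall s, is_extension t false s -> a s = P') /\
        (forall s, is_extension t true s -> a s = ~` P')].

Definition successor_nodes : set (node K) :=
  [set s | is_successor (len s) \/ is_empty s].

End Tree.

Definition boolean_subalgebra (B : set (set nat)) :=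
  [/\ B set0, B setT, forall A, B A -> B (~` A), setU_closed B & setI_closed B].

Definition T_algebra d (K : orderType d) (T : set (node K))
    (a : node K -> set nat) : set (set nat) :=
  smallest boolean_subalgebra ((a @` T) `|` [set A | finite_set A]).

Definition ultrafilter_on (B u : set (set nat)) :=
  [/\ u `<=` B, u setT /\ ~ u set0, setI_closed u,
      forall b c, u b -> B c -> b `<=` c -> u c
    & forall b, B b -> u b \/ u (~` b)].

Record stone (B : set (set nat)) := Stone {
  ultra :> set (set nat);
  ultraP : ultrafilter_on B ultra
}.

HB.instance Definition _ B := gen_eqMixin (stone B).
HB.instance Definition _ B := gen_choiceMixin (stone B).

Section StoneTopology.
Variable B : set (set nat).

Definition stone_base (b : set nat) : set (stone B) := [set u | ultra u b].

Lemma stone_base_cover : \bigcup_(b in B) stone_base b = setT.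
Proof.
apply/seteqP; split=> // u _; have [uB [uT _] _ _ _] := ultraP u.
by exists setT => //; exact: uB.
Qed.

Lemma stone_base_join b c (u : stone B) : B b -> B c ->
  stone_base b u -> stone_base c u ->
  exists e, [/\ B e, stone_base e u & stone_base e `<=` stone_base b `&` stone_base c].
Proof.
move=> Bb Bc ub uc; have [uB _ uI _ _] := ultraP u.
have ubc : ultra u (b `&` c) by exact: uI.
exists (b `&` c); split=> //; first exact: uB.
move=> v vbc; have [_ _ _ vS _] := ultraP v.
by split; apply: vS vbc _ _ => // n [].
Qed.

HB.instance Definition _ :=
  isBaseTopological.Build (stone B) stone_base_cover stone_base_join.

End StoneTopology.

Definition sequentially_compact (X : topologicalType) :=
  forall x : nat -> X, exists k : nat -> nat,
    {homo k : m n / (m < n)%N} /\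
    exists l : X, x (k n) @[n --> \oo] --> l.

(* Main.v *)
Require Import Defs.
From mathcomp Require Import all_boot all_order.
From mathcomp Require Import boolp classical_sets topology.
From mathcomp Require Import cardinality wochoice.

(** The plan is to find, inside the index set of a given sequence of
    ultrafilters, an infinite set Y along which every generator is decided:
    almost all ultrafilters indexed by Y contain it, or almost all omit it.
    The elements of the algebra decided along Y form a Boolean subalgebra, so
    then all of them are decided, and those lying in almost all the
    ultrafilters make up the limit (limit_of_decided).

    If a single {m} lies in infinitely many of the ultrafilters, these are all
    equal and form a convergent subsequence. Otherwise sending a set A to the
    set of indices n such that the n-th ultrafilter contains a subset of A
    transports almost inclusion of subsets of omega to almost inclusion of
    sets of indices, and transports complements of members of the algebra to
    complements. The labels of all nodes, limit ones included, are thereby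
    turned into a family of sets of indices with the three features of the
    labeling that matter (coherent): the labels of the two extensions of a
    node are complementary, the label of an extension by 0 is almost contained
    in all labels below it, and so is the label of a node of limit length.

    It remains to see that for such a family C every infinite X has an
    infinite subset deciding all successor nodes (decided_subset). Suppose
    not. A set almost contained in all labels at or below a node w can only be
    split by extensions q0 of nodes q at or above w (undecided_above): for any
    other q, the label of q0 is one of the labels at or below w, or is almost
    contained in the complement of one of them. Put W 0 = X and let W (n+1) be
    the intersection of W n with the label of an extension by 0 that splits W
    n; these splitting nodes increase. Let Y be an infinite pseudointersection
    of the W n. A node splitting Y is above all the nodes used so far, so
    these nodes have a union t, of limit length. Now C t is almost contained
    in each of the labels used, and W n is split by the n-th of these, hence
    every W n \ C t is infinite, and Y can be chosen disjoint from C t. But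
    the node splitting Y extends t by a 0 somewhere at or above t, so its
    label is almost contained in C t, and Y is almost disjoint from it. This
    is a contradiction. *)

Set Implicit Arguments.
Unset Strict Implicit.
Unset Printing Implicit Defensive.

Import Order.TTheory.
Local Open Scope order_scope.
Local Open Scope classical_set_scope.

(** * Almost inclusion and diagonal choices *)

Lemma finite_setD_trans T (A B C : set T) :
  finite_set (A `\` B) -> finite_set (B `\` C) -> finite_set (A `\` C).
Proof.
move=> AB BC; apply: (sub_finite_set (B := (A `\` B) `|` (B `\` C))).
  by move=> x [Ax nCx]; have [Bx|nBx] := pselect (B x); [right|left].
by rewrite finite_setU.
Qed.

Lemma finite_setD_sub T (A B : set T) : A `<=` B -> finite_set (A `\` B).
Proof. by move=> AB; rewrite (_ : A `\` B = set0) // setD_eq0. Qed.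

Lemma increasing_selection (W : nat -> set nat) :
  (forall n, infinite_set (W n)) ->
  exists2 k : nat -> nat, {homo k : m n / (m < n)%N} & forall n, W n (k n).
Proof.
move=> Winf.
have beyond (nN : nat * nat) : exists m, W nN.1 m /\ (nN.2 < m)%N.
  apply: contrapT => /forallNP noW; apply: (Winf nN.1).
  apply: sub_finite_set (finite_II nN.2.+1) => m Wm /=.
  by rewrite ltnS leqNgt; apply/negP => Nm; apply: (noW m).
have [next nextP] := choice beyond.
pose k := fix k n := if n is n'.+1 then next (n, k n') else next (0, 0).
exists k; last by case=> [|n] /=; [have [] := nextP (0, 0)|
  have [] := nextP (n.+1, k n)].
apply: homo_ltn => [m n p|n]; first exact: ltn_trans.
by have [] := nextP (n.+1, k n).
Qed.

Lemma homo_id_leq (k : nat -> nat) :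
  {homo k : m n / (m < n)%N} -> forall n, (n <= k n)%N.
Proof. by move=> kinc; elim=> // n /leq_ltn_trans; apply; exact: kinc. Qed.

Lemma finite_set_nat_ub (A : set nat) : finite_set A ->
  exists N, A `<=` `I_N.
Proof.
move=> /finite_seqP[s ->]; exists (\max_(i <- s) i).+1 => i /= si.
by rewrite ltnS (leq_bigmax_seq (P := xpredT) (F := id)).
Qed.

(** The selected points k n of W n form the pseudointersection. *)
Lemma decreasing_pseudointersection (W : nat -> set nat) :
  (forall n, infinite_set (W n)) -> (forall n, W n.+1 `<=` W n) ->
  exists Y, [/\ infinite_set Y, Y `<=` W 0 & forall n, finite_set (Y `\` W n)].
Proof.
move=> Winf Wdec; have [k kinc Wk] := increasing_selection Winf.
have Wle m n : (m <= n)%N -> W n `<=` W m.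
  by move=> /subnK <-; elim: (n - m)%N => // i IH x; rewrite addSn => /Wdec/IH.
exists (range k); split.
- have kinj : injective k.
    by move=> m n kmn; case: (ltngtP m n) => // /kinc; rewrite kmn ltnn.
  move=> fin; apply: infinite_nat.
  have -> : [set: nat] = k @^-1` range k.
    by apply/seteqP; split=> // n _; exists n.
  by apply: finite_preimage fin => m n _ _ /kinj.
- by move=> _ [n _ <-]; exact: (Wle 0 n).
- move=> n; apply: (sub_finite_set (B := k @` `I_n)); last first.
    exact/finite_image/finite_II.
  move=> _ [[m _ <-] nWm]; exists m => //=.
  by rewrite ltnNge; apply/negP => nm; apply/nWm/(Wle n m).
Qed.

(** * Coherent families of sets indexed by nodes *)

Section CoherentFamilies.
Context {d : Order.disp_t} {K : orderType d}.
Hypothesis woK : well_order (<=%O : rel K).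
Implicit Types (b c : K) (f g : K -> bool).

Lemma least_element (P : set K) : (exists b, P b) ->
  exists2 b, P b & forall c, P c -> b <= c.
Proof.
move=> [b Pb]; have [|m [[Pm mle] _]] := woK (A := [pred x | `[< P x >]]).
  by exists b; exact/asboolP.
exists m => [|c Pc]; first exact/asboolP.
by apply: mle; exact/asboolP.
Qed.

(** A pair (b, f) stands for the node of length b with values f c at c < b;
    the values of f at and above b are junk.  Then (b', f) is an extension of
    (b, f) by f b whenever succ_of b b'. *)
Definition succ_of b b' := b < b' /\ forall c, c < b' -> c <= b.

Lemma succ_exists b c : b < c -> exists2 b', succ_of b b' & b' <= c.
Proof.
move=> bc; have [|b' bb' b'le] := least_element (P := [set x | b < x]).
  by exists c.
exists b'; last exact: b'le.
split=> // x xb'; rewrite leNgt; apply/negP => /b'le.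
by rewrite leNgt xb'.
Qed.

Definition agree_below b f g := forall c, c < b -> f c = g c.

(** Complements and almost inclusions are what survives when labels, which are
    sets of points of omega, are replaced by sets of indices. *)
Record coherent (C : K -> (K -> bool) -> set nat) := Coherent {
  coh_ext : forall b f g, agree_below b f g -> C b f = C b g;
  coh_compl : forall b b' f g, succ_of b b' -> agree_below b f g ->
    f b <> g b -> C b' f = ~` C b' g;
  coh_zero : forall b b' c f, succ_of b b' -> f b = false -> c <= b' ->
    finite_set (C b' f `\` C c f);
  coh_limit : forall b c f, is_limit b -> c <= b ->
    finite_set (C b f `\` C c f)
}.

Definition decided (Y A : set nat) :=
  finite_set (Y `&` A) \/ finite_set (Y `\` A).

Lemma decidedC Y A : decided Y A -> decided Y (~` A).
Proof. by case=> fin; [right; rewrite setDE setCK|left; rewrite -setDE]. Qed.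

Lemma decidedI Y A B : decided Y A -> decided Y B -> decided Y (A `&` B).
Proof.
move=> [YA _|YA [YB|YB]].
- by left; apply: sub_finite_set YA => n [? []].
- by left; apply: sub_finite_set YB => n [? []].
- by right; rewrite setDIr finite_setU.
Qed.

Section Decision.
Variable C : K -> (K -> bool) -> set nat.
Hypothesis cohC : coherent C.

(** Let x be the first place where the node (c', g) departs from (b, f).  The
    set Z is almost contained in the label of the extension (x', f) of the
    common part.  If (c', g) is itself an extension of the common part, it is
    (x', f) or its sibling, so Z decides it; otherwise it lies above the sibling
    (x', g), whose label is the complement of that of (x', f). *)
Lemma undecided_above (Z : set nat) b f c c' g :
  (forall e, e <= b -> is_successor e -> finite_set (Z `\` C e f)) ->
  succ_of c c' -> g c = false -> ~ decided Z (C c' g) ->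
  b <= c /\ agree_below b f g.
Proof.
move=> Zf cc' gc0 undec; have [cltc' c'le] := cc'.
suff all_ok e : e < b -> e < c /\ f e = g e.
  split=> [|e /all_ok[]//]; rewrite leNgt; apply/negP => /all_ok[].
  by rewrite ltxx.
apply: contraPP => bad eb.
have [|x [xb nx] xmin] :=
    least_element (P := [set x | x < b /\ ~ (x < c /\ f x = g x)]).
  by exists e.
have below y : y < x -> y < c /\ f y = g y.
  move=> yx; apply: contrapT => ny.
  have := xmin y (conj (lt_trans yx xb) ny); by rewrite leNgt yx.
have fg : agree_below x f g by move=> y /below[].
have xc : x <= c by rewrite leNgt; apply/negP => /below[]; rewrite ltxx.
have [x' xx' x'b] := succ_exists xb.
have Zx' : finite_set (Z `\` C x' f).
  by apply: Zf => //; exists x; [case: xx'|case: xx'].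
have x'c' : x' <= c'.
  rewrite leNgt; apply/negP => /xx'.2; rewrite leNgt.
  by rewrite (le_lt_trans xc cltc').
have [fgx|fgx] := pselect (f x = g x).
  have xE : x = c.
    by apply/eqP; rewrite eq_le xc leNgt; apply/negP => xc'; exact: nx.
  have x'E : x' = c'.
    apply/eqP; rewrite eq_le x'c' leNgt; apply/negP => /c'le.
    by rewrite -xE leNgt xx'.1.
  apply: undec; right; rewrite -x'E -(@coh_ext _ cohC x' f g) //.
  move=> y /xx'.2; rewrite le_eqVlt => /orP[/eqP->//|]; exact: fg.
apply: undec; left.
have gx' := coh_zero cohC cc' gc0 x'c'.
apply: (sub_finite_set (B := (Z `\` C x' f) `|` (C c' g `\` C x' g))).
  move=> n [Zn cn]; rewrite (coh_compl cohC xx' fg fgx).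
  by have [gn|ngn] := pselect (C x' g n); [left; split=> // /(_ gn)|right].
by rewrite finite_setU.
Qed.

(** Splitting again and again by extensions by 0 keeps each set W n almost
    contained in all labels at or below the node that split its predecessor, so
    that the splitting nodes cannot leave a single branch. *)
Lemma decided_zero_subset (X : set nat) : infinite_set X ->
  exists Y, [/\ infinite_set Y, Y `<=` X & forall b b' f, succ_of b b' ->
    f b = false -> decided Y (C b' f)].
Proof.
move=> Xinf; apply: contrapT => noY.
have undec Y : Y `<=` X -> infinite_set Y -> exists p : K * K * (K -> bool),
    [/\ succ_of p.1.1 p.1.2, p.2 p.1.1 = false & ~ decided Y (C p.1.2 p.2)].
  move=> YX Yinf; apply: contrapT => nop; apply: noY; exists Y; split=> //.
  move=> b b' f bb' fb; apply: contrapT => nd; apply: nop.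
  by exists (b, b', f).
have split_ex (Y : set nat) : exists p : K * K * (K -> bool),
    Y `<=` X -> infinite_set Y ->
    [/\ succ_of p.1.1 p.1.2, p.2 p.1.1 = false & ~ decided Y (C p.1.2 p.2)].
  have [[YX Yinf]|nY] := pselect (Y `<=` X /\ infinite_set Y).
    by have [p pP] := undec Y YX Yinf; exists p.
  (* A junk value, which exists because X itself is split. *)
  have [p _] := undec X (@subset_refl _ X) Xinf.
  by exists p => YX Yinf; case: nY.
have {split_ex} [F FP] := choice split_ex.
pose W n := iter n (fun Y => Y `&` C (F Y).1.2 (F Y).2) X.
pose b n := (F (W n)).1.1; pose b' n := (F (W n)).1.2; pose f n := (F (W n)).2.
have WS n : W n.+1 = W n `&` C (b' n) (f n) by [].
have Wdec n : W n.+1 `<=` W n by rewrite WS; apply: subIsetl.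
have WX n : W n `<=` X.
  by elim: n => // n IH; apply: subset_trans (Wdec n) IH.
have Winf n : infinite_set (W n).
  elim: n => // n Winf; rewrite WS.
  by have [_ _ nd] := FP _ (WX n) Winf; move=> fin; apply: nd; left.
have Wsplit n : [/\ succ_of (b n) (b' n), f n (b n) = false &
    ~ decided (W n) (C (b' n) (f n))] by exact: FP.
(* Splitting nodes found later lie above all the earlier ones. *)
have above n Z c c' g : finite_set (Z `\` W n.+1) -> succ_of c c' ->
    g c = false -> ~ decided Z (C c' g) ->
    b' n <= c /\ agree_below (b' n) (f n) g.
  move=> ZW cc' gc nd; apply: undecided_above cc' gc nd => e eb' _.
  have [bb' fb _] := Wsplit n.
  apply: finite_setD_trans (coh_zero cohC bb' fb eb').
  apply: finite_setD_trans ZW _.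
  by apply: finite_setD_sub; rewrite WS; apply: subIsetr.
have b'_lt n : b' n < b' n.+1.
  have [bb' fb nd] := Wsplit n.+1.
  have [le_b _] := above n (W n.+1) _ _ _ (finite_setD_sub (@subset_refl _ _))
    bb' fb nd.
  exact: le_lt_trans le_b bb'.1.
pose over c g := forall n, b' n <= c /\ agree_below (b' n) (f n) g.
have over_split Y : infinite_set Y -> Y `<=` X ->
    (forall n, finite_set (Y `\` W n)) ->
    exists c c' g,
      [/\ succ_of c c', g c = false, ~ decided Y (C c' g) & over c g].
  move=> Yinf YX YW; have [cc' gc nd] := FP Y YX Yinf.
  exists (F Y).1.1, (F Y).1.2, (F Y).2; split=> // n.
  exact: above (YW n.+1) cc' gc nd.
(* The union of the splitting nodes either is a whole branch of the tree, or is
   the node (l, g) introduced below. *)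
have [[c [g cg]]|none] := pselect (exists c g, over c g); last first.
  have [Y [Yinf YX YW]] := decreasing_pseudointersection Winf Wdec.
  have [c [_ [g [_ _ _ cg]]]] := over_split Y Yinf YX YW.
  by apply: none; exists c, g.
have [|l lub lmin] := least_element (P := [set l | forall n, b' n <= l]).
  by exists c => n; case: (cg n).
have ltl x : x < l -> exists n, x < b' n.
  move=> xl; apply: contrapT => /forallNP nx; suff : l <= x by rewrite leNgt xl.
  by apply: lmin => n; rewrite leNgt; apply/negP/nx.
have b'l n : b' n < l := lt_le_trans (b'_lt n) (lub n.+1).
have liml : is_limit l.
  split; first by exists (b' 0).
  move=> [x xl lx]; have [n xn] := ltl x xl.
  by have := lx _ (b'l n); rewrite leNgt xn.
pose V n := W n `\` C l g.
have Vinf n : infinite_set (V n).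
  have [_ _ nd] := Wsplit n; move=> Vfin; apply: nd; right.
  apply: finite_setD_trans Vfin _; rewrite (coh_ext cohC (cg n).2).
  exact (coh_limit cohC g liml (lub n)).
have Vdec n : V n.+1 `<=` V n by move=> x [/Wdec].
have [Y [Yinf YV YVn]] := decreasing_pseudointersection Vinf Vdec.
have YX : Y `<=` X by move=> n /YV[].
have YW n : finite_set (Y `\` W n).
  by apply: sub_finite_set (YVn n) => x [Yx nWx]; split=> // -[].
have [e [e' [h [ee' he nd eh]]]] := over_split Y Yinf YX YW.
have le_e' : l <= e'.
  by apply: ltW; apply: le_lt_trans ee'.1; apply: lmin => n; case: (eh n).
have hg : agree_below l h g.
  by move=> x /ltl[n xn]; rewrite -(eh n).2 // (cg n).2.
apply: nd; left; apply: sub_finite_set (coh_zero cohC ee' he le_e').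
move=> x [/YV[_ nCx] Cx]; split=> //; by rewrite (coh_ext cohC hg).
Qed.

(** An extension by 1 has the label complementary to its sibling by 0. *)
Lemma decided_subset (X : set nat) : infinite_set X ->
  exists Y, [/\ infinite_set Y, Y `<=` X &
    forall b f, is_successor b -> decided Y (C b f)].
Proof.
move=> /decided_zero_subset[Y [Yinf YX Ydec]]; exists Y; split=> //.
move=> b' f [b bb' b'le].
have sb : succ_of b b' by [].
have [fb|fb] := boolP (f b); last by apply: (Ydec b) => //; exact/negbTE.
pose g c := if c == b then false else f c.
rewrite (coh_compl cohC (g := g) sb).
- by apply/decidedC/(Ydec b); rewrite // /g eqxx.
- by move=> c cb; rewrite /g lt_eqF.
- by rewrite /g eqxx fb.
Qed.

End Decision.

End CoherentFamilies.

(** * From labelings to coherent families *)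

Section Nodes.
Context {d : Order.disp_t} {K : orderType d}.
Implicit Types (b c : K) (f g : K -> bool) (s t : node K).

(** With values given on all of K, a node is restricted by changing only its
    length. *)
Definition trunc b f : node K := @Node d K b (fun x => f (proj1_sig x)).

Lemma graph_trunc b f : graph (trunc b f) = [set p | p.1 < b /\ f p.1 = p.2].
Proof. by apply/seteqP; split=> -[c i] /= [h E]; [split|exists h]. Qed.

Lemma truncE s : exists f, s = trunc (len s) f.
Proof.
case: s => b v; pose f c := if pselect (c < b) is left h then v (exist _ c h)
  else false.
exists f; rewrite /trunc /=; congr Node; apply/funext => -[c h].
rewrite /f /=; case: pselect => // h'.
by congr (v (exist _ c _)); exact: bool_irrelevance.
Qed.

Lemma eq_trunc b f g : agree_below b f g -> trunc b f = trunc b g.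
Proof.
by move=> fg; congr Node; apply/funext => -[c h]; exact: fg.
Qed.

Lemma trunc_le b c f : c <= b -> node_le (trunc c f) (trunc b f).
Proof.
move=> cb; rewrite /node_le !graph_trunc => -[x i] /= [xc fx].
by split=> //; exact: lt_le_trans cb.
Qed.

Lemma trunc_lt b c f : c < b -> node_lt (trunc c f) (trunc b f).
Proof.
move=> cb; split; first exact/trunc_le/ltW.
rewrite !graph_trunc => /(_ (c, f c)) /= [] //.
by rewrite ltxx.
Qed.

Lemma trunc_extension b b' f : succ_of b b' ->
  is_extension (trunc b f) (f b) (trunc b' f).
Proof.
move=> [bb' b'le]; rewrite /is_extension !graph_trunc.
apply/seteqP; split=> [[x i] /= [xb' fx]|[x i] /=].
  have := b'le x xb'; rewrite le_eqVlt => /orP[/eqP xE|xb]; last by left.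
  by right; rewrite -fx xE.
by case=> [[xb fx]|[-> ->]]; split=> //; exact: lt_trans bb'.
Qed.

Lemma labels_coherent (a : node K -> set nat) :
  pseudointersection_labeling a -> coherent (fun b f => a (trunc b f)).
Proof.
move=> [_ _ alim aext]; split.
- by move=> b f g /eq_trunc ->.
- move=> b b' f g bb' fg ne.
  have := trunc_extension f bb'; have := trunc_extension g bb'.
  rewrite -(eq_trunc fg).
  have [P [P' [_ [a0 a1]]]] := aext (trunc b f).
  case: (f b) (g b) ne => -[] // _ extg extf.
    by rewrite (a0 _ extg) (a1 _ extf).
  by rewrite (a0 _ extf) (a1 _ extg) setCK.
- move=> b b' c f bb' fb; rewrite le_eqVlt => /orP[/eqP ->|cb'].
    exact: finite_setD_sub.
  have := trunc_extension f bb'; rewrite fb => extf.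
  have [P [P' [[_ Pps P'P _ _] [a0 _]]]] := aext (trunc b f).
  rewrite (a0 _ extf).
  apply: finite_setD_trans (finite_setD_sub P'P) _.
  by apply: Pps; exists (trunc c f) => //; apply: trunc_le; exact: bb'.2.
- move=> b c f limb; rewrite le_eqVlt => /orP[/eqP ->|cb].
    exact: finite_setD_sub.
  apply: (alim (trunc b f) limb); exists (trunc c f) => //.
  exact: trunc_lt.
Qed.

(** Complements need to be respected only at successor lengths, whose labels are
    the generators of the algebra. *)
Lemma coherent_comp (C : K -> (K -> bool) -> set nat) (h : set nat -> set nat) :
  coherent C ->
  (forall A B, finite_set (A `\` B) -> finite_set (h A `\` h B)) ->
  (forall b f, is_successor b -> h (~` C b f) = ~` h (C b f)) ->
  coherent (fun b f => h (C b f)).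
Proof.
move=> cohC hfin hC; split.
- by move=> b f g /(coh_ext cohC) ->.
- move=> b b' f g bb' fg ne; rewrite (coh_compl cohC bb' fg ne) hC //.
  by exists b; case: bb'.
- by move=> b b' c f bb' fb cb'; apply: hfin; exact (coh_zero cohC bb' fb cb').
- by move=> b c f lb cb; apply: hfin; exact (coh_limit cohC f lb cb).
Qed.

End Nodes.

(** * Convergence in Stone spaces *)

Lemma smallest_boolean_subalgebra (G : set (set nat)) :
  boolean_subalgebra (smallest boolean_subalgebra G).
Proof.
split.
- by move=> B [[]].
- by move=> B [[]].
- by move=> A SA B [Bs GB]; case: (Bs) => _ _ + _ _; apply; exact: SA.
- by move=> A A' SA SA' B [Bs GB]; case: (Bs) => _ _ _ + _; apply;
    [exact: SA|exact: SA'].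
- by move=> A A' SA SA' B [Bs GB]; case: (Bs) => _ _ _ _; apply;
    [exact: SA|exact: SA'].
Qed.

(** The sets stone_base b with b in l are a neighborhood base of l. *)
Lemma cvg_stone (B : set (set nat)) (x : nat -> stone B) (l : stone B) :
  (forall b, ultra l b -> exists N, forall n, (N <= n)%N -> ultra (x n) b) ->
  x @ \oo --> l.
Proof.
move=> xl A; rewrite nbhsE => -[V [[D DB <-] [b Db lb]] VA].
have [N xN] := xl b lb; exists N => // n /= Nn.
by apply: VA; exists b => //; exact: xN.
Qed.

Lemma ultrafilter_notC (B : set (set nat)) (u : stone B) b : B b ->
  ultra u (~` b) <-> ~ ultra u b.
Proof.
move=> Bb; have [_ [_ u0] uI _ uU] := ultraP u; split.
  by move=> nb ub; apply: u0; rewrite -(setICr b); exact: uI.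
by move=> nb; case: (uU b Bb).
Qed.

Lemma principal_ultrafilters (B : set (set nat)) (u v : stone B) m :
  ultra u [set m] -> ultra v [set m] -> ultra u `<=` ultra v.
Proof.
move=> um vm b ub; have [uB [_ u0] uI _ _] := ultraP u.
have [_ _ _ vS _] := ultraP v; apply: vS vm (uB _ ub) _ => _ ->.
apply: contrapT => nb; apply: u0; rewrite (_ : set0 = b `&` [set m]).
  exact: uI.
by apply/esym/seteqP; split=> // n [bn nm]; apply: nb; rewrite -nm.
Qed.

Section Traces.
Variable B : set (set nat).
Hypothesis Bs : boolean_subalgebra B.
Variable x : nat -> stone B.

(** On B this is a Boolean homomorphism to the sets of indices. *)
Definition trace b := [set n | ultra (x n) b].

Lemma trace_sub b c : B c -> b `<=` c -> trace b `<=` trace c.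
Proof.
by move=> Bc bc n xb; have [_ _ _ + _] := ultraP (x n); apply; [exact: xb| |].
Qed.

Lemma trace0 : trace set0 = set0.
Proof. by apply/seteqP; split=> n //=; have [_ []] := ultraP (x n). Qed.

Lemma traceC b : B b -> trace (~` b) = ~` trace b.
Proof. by move=> Bb; apply/seteqP; split=> n /= /ultrafilter_notC; apply. Qed.

Lemma traceI b c : B b -> B c -> trace (b `&` c) = trace b `&` trace c.
Proof.
move=> Bb Bc; apply/seteqP; split=> [n xbc|n [xb xc]].
  by split; apply: trace_sub xbc => // m [].
by have [_ _ + _ _] := ultraP (x n); apply.
Qed.

Lemma decided_subalgebra Y :
  boolean_subalgebra [set b | B b /\ decided Y (trace b)].
Proof.
have [B0 BT BC BU BI] := Bs.
have dC b : B b /\ decided Y (trace b) -> B (~` b) /\ decided Y (trace (~` b)).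
  by case=> Bb dec; rewrite traceC //; split; [exact: BC|exact: decidedC].
have dI b c : B b /\ decided Y (trace b) -> B c /\ decided Y (trace c) ->
    B (b `&` c) /\ decided Y (trace (b `&` c)).
  move=> [Bb decb] [Bc decc]; rewrite traceI //.
  by split; [exact: BI|exact: decidedI].
have d0 : B set0 /\ decided Y (trace set0).
  by split=> //; rewrite trace0; left; rewrite setI0.
split=> //.
- by rewrite /= -setC0; exact: dC.
- by move=> b c db dc; rewrite -(setCK (b `|` c)) setCU; apply/dC/dI; exact: dC.
Qed.

Lemma limit_of_decided Y : infinite_set Y ->
  (forall b, B b -> decided Y (trace b)) ->
  exists2 k : nat -> nat, {homo k : m n / (m < n)%N} &
    exists l : stone B, x (k n) @[n --> \oo] --> l.
Proof.
move=> Yinf dec; have [_ BT BC _ BI] := Bs.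
have [k kinc Yk] := @increasing_selection (fun=> Y) (fun=> Yinf).
exists k => //.
pose L := [set b | B b /\ finite_set (Y `\` trace b)].
have LU : ultrafilter_on B L.
  split.
  - by move=> b [].
  - split.
      split=> //; apply: finite_setD_sub => n _.
      by have [_ []] := ultraP (x n).
    by move=> [_]; rewrite trace0 setD0.
  - move=> b c [Bb Lb] [Bc Lc]; split; first exact: BI.
    by rewrite traceI // setDIr finite_setU.
  - move=> b c [Bb Lb] Bc bc; split=> //.
    exact: finite_setD_trans Lb (finite_setD_sub (trace_sub Bc bc)).
  - move=> b Bb; have [fin|fin] := dec b Bb; [right|left]; split=> //.
      exact: BC.
    by rewrite traceC // setDE setCK.
exists (Stone LU); apply: cvg_stone => b [Bb /finite_set_nat_ub[N Nub]].
exists N => n Nn; apply: contrapT => nx.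
have := Nub (k n) (conj (Yk n) nx); rewrite /= ltnNge.
by rewrite (leq_trans Nn) // homo_id_leq.
Qed.

Section Escaping.
Hypothesis Bfin : forall A, finite_set A -> B A.
Hypothesis escape : forall m, finite_set (trace [set m]).

(** An ultrafilter containing a finite set contains one of its points. *)
Lemma trace_finite A : finite_set A -> finite_set (trace A).
Proof.
have [_ _ BC _ _] := Bs.
move=> /finite_seqP[s ->]; elim: s => [|m s IH].
  by rewrite set_nil trace0.
have : finite_set (trace [set m] `|` trace [set` s]) by rewrite finite_setU.
apply: sub_finite_set => n xms.
have [xm|nm] := pselect (trace [set m] n); [by left|right].
have xmC : trace (~` [set m]) n by rewrite traceC //; exact: Bfin.
have Bms : B [set` m :: s] by exact/Bfin/finite_seq.
have : trace ([set` m :: s] `&` ~` [set m]) n.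
  by rewrite traceI //; exact/BC/Bfin.
apply: trace_sub; first exact/Bfin/finite_seq.
by move=> i [/=]; rewrite inE => /orP[/eqP|].
Qed.

(** The trace extended to sets outside the algebra, as labels of nodes of limit
    length may be. *)
Definition inner_trace A := [set n | exists2 b, ultra (x n) b & b `<=` A].

Lemma inner_traceE b : B b -> inner_trace b = trace b.
Proof.
move=> Bb; apply/seteqP; split=> [n [c xc cb]|n xb]; last by exists b.
exact: trace_sub cb _ xc.
Qed.

(** If A \ A' is finite, it is in almost none of the ultrafilters, so almost
    always a member inside A can be shrunk to one inside A'. *)
Lemma inner_trace_almost_sub A A' :
  finite_set (A `\` A') -> finite_set (inner_trace A `\` inner_trace A').
Proof.
move=> AA'; apply: sub_finite_set (trace_finite AA') => n [[b xb bA] nh].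
have [xB _ xI _ _] := ultraP (x n).
apply: contrapT => nf; apply: nh; exists (b `&` ~` (A `\` A')).
  by apply: xI => //; apply/ultrafilter_notC => //; exact: Bfin.
by move=> i [/bA Ai nAA']; apply: contrapT => nA'; apply: nAA'.
Qed.

End Escaping.

End Traces.

Theorem theorem4p10 (d : Order.disp_t) (K : orderType d)
    (hK : is_pseudointersection_number K)
    (a : node K -> set nat) (ha : pseudointersection_labeling a) :
  sequentially_compact (stone (T_algebra successor_nodes a)).
Proof.
have woK : well_order (<=%O : rel K) by case: hK => -[].
set B := T_algebra successor_nodes a.
have Bs : boolean_subalgebra B by exact: smallest_boolean_subalgebra.
have [_ _ BC _ _] := Bs.
have Bfin A : finite_set A -> B A by move=> fA; apply: sub_gen_smallest; right.
have Bnode s : successor_nodes s -> B (a s).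
  by move=> Ts; apply: sub_gen_smallest; left; exists s.
move=> x.
have [[m minf]|escape] := pselect (exists m, infinite_set (trace x [set m])).
  have [k kinc km] := increasing_selection (fun=> minf).
  exists k; split=> //; exists (x (k 0)); apply: cvg_stone => b xb.
  by exists 0 => n _; apply: principal_ultrafilters (km 0) (km n) _ xb.
have {}escape m : finite_set (trace x [set m]).
  by apply: contrapT => mi; apply: escape; exists m.
have cohC : coherent (fun b f => inner_trace x (a (trunc b f))).
  apply: coherent_comp (labels_coherent ha) _ _ => [A A'|b f sb].
    exact: inner_trace_almost_sub.
  have Bb : B (a (trunc b f)) by apply: Bnode; left.
  by rewrite !inner_traceE ?traceC //; exact: BC.
have [Y [Yinf _ Ydec]] := decided_subset woK cohC infinite_nat.
suff BD : B `<=` [set b | B b /\ decided Y (trace x b)].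
  have [b /BD[]//|k kinc kl] := limit_of_decided Bs (x := x) Yinf; by exists k.
apply: smallest_sub; first exact: decided_subalgebra.
move=> A [[s Ts <-]|fA]; last first.
  split; first exact: Bfin.
  by left; apply: sub_finite_set (trace_finite Bs Bfin escape fA) => n [].
split; first exact: Bnode.
case: Ts => [sT|sem].
  have [f ->] := truncE s; rewrite -inner_traceE; first exact: Ydec.
  by apply: Bnode; left.
have [_ aT _ _] := ha; rewrite aT //; right; apply: finite_setD_sub => n _.
by have [_ []] := ultraP (x n).
Qed.
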